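(* Let $n$ and $k$ be integers with $1 \le k \le n$. If $n < 2k$, then the Sprague-Grundy function $\mathcal{G}$ of the game Exact $k$-Nim on $n$ piles, $\mathrm{Nim}^{=}_{n,k}$, is equal to its Tetris function: $\mathcal{G}(x) = T_{n,k}(x)$ for every position $x \in \mathbb{Z}_{\ge}^n$.
   Context: $\mathbb{Z}_{\ge}$ denotes the set of nonnegative integers. For integers $1 \le k \le n$, Exact $k$-Nim, denoted $\mathrm{Nim}^{=}_{n,k}$, is the following impartial game. A position is a vector $x=(x_1,\dots,x_n) \in \mathbb{Z}_{\ge}^n$, where $x_i$ is the number of tokens in pile $i$. A move $x \to x'$ consists of choosing exactly $k$ piles and removing an arbitrary positive number of tokens from each of them (so exactly $k$ coordinates strictly decrease, remaining nonnegative, and the other coordinates are unchanged). The game terminates when there are fewer than $k$ nonempty piles; the player who makes the last move wins. The Sprague-Grundy function is defined recursively by $\mathcal{G}(x) = \operatorname{mex}\{\mathcal{G}(y) \mid x \to y\}$, where $\operatorname{mex}(S)$ is the smallest nonnegative integer not in $S$ (and $\operatorname{mex}(\emptyset)=0$). The Tetris function value $T_{n,k}(x)$ is the maximum number of consecutive moves of $\mathrm{Nim}^{=}_{n,k}$ that can be made starting from $x$. *)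

(* Defs.v *)
From mathcomp Require Import all_boot.
Set Implicit Arguments.
Unset Strict Implicit.
Unset Printing Implicit Defensive.

Notation position n := {ffun 'I_n -> nat}.

Section ExactNim.
Variables n k : nat.
Implicit Types x y : position n.

Definition move x y : bool :=
  [forall i, y i <= x i] && (#|[set i | y i < x i]| == k).

Definition tokens x : nat := \sum_i x i.

Definition below x : seq (position n) :=
  [seq [ffun i => val (f i)] | f : {ffun 'I_n -> 'I_(\max_i x i).+1}].

Definition options x : seq (position n) := [seq y <- below x | move x y].

Lemma mem_options x y : (y \in options x) = move x y.
Proof.
rewrite mem_filter; case mxy: (move x y) => //=.
case/andP: mxy => /forallP le_yx _.
have lt_y i : y i < (\max_i x i).+1.
  by rewrite ltnS (leq_trans (le_yx i)) // leq_bigmax.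
apply/imageP; exists [ffun i => Ordinal (lt_y i)] => //.
by apply/ffunP=> i; rewrite !ffunE.
Qed.

Lemma move_tokens x y : 0 < k -> move x y -> tokens y < tokens x.
Proof.
move=> k_gt0 /andP[/forallP le_yx /eqP card_k].
have /card_gt0P[i] : 0 < #|[set i | y i < x i]| by rewrite card_k.
rewrite inE => lt_i; rewrite /tokens (bigD1 i) //= [X in _ < X](bigD1 i) //=.
by rewrite -addSn leq_add // leq_sum.
Qed.

Lemma ex_notin (s : seq nat) : exists m, m \notin s.
Proof.
exists (\max_(i <- s) i).+1; apply/negP=> in_s.
by have := @leq_bigmax_seq _ s xpredT id _ in_s isT; rewrite ltnn.
Qed.

Definition mex (s : seq nat) : nat := ex_minn (ex_notin s).

(* The recursion G(x) = mex {G(y) | x -> y}, run with fuel: for 0 < k every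
   move removes a token, so fuel (tokens x) suffices (see sgE). *)
Fixpoint sg_rec (fuel : nat) x : nat :=
  if fuel is fuel'.+1 then mex [seq sg_rec fuel' y | y <- options x]
  else mex [::].

Definition sg x : nat := sg_rec (tokens x) x.

Lemma sgE x : 0 < k -> sg x = mex [seq sg y | y <- options x].
Proof.
move=> k_gt0.
have fuelE m1 : forall m2 z, tokens z <= m1 -> tokens z <= m2 ->
    sg_rec m1 z = sg_rec m2 z.
  have opt0 z : tokens z <= 0 -> options z = [::].
    move=> z0; case def_o: (options z) => [//|y s].
    have: y \in options z by rewrite def_o mem_head.
    by rewrite mem_options => /(move_tokens k_gt0) /leq_trans/(_ z0).
  elim: m1 => [|m1 IHm] [|m2] z z1 z2 //=; try by rewrite opt0.
  congr mex; apply/eq_in_map=> y; rewrite mem_options => /(move_tokens k_gt0).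
  by move=> lt_yz; apply: IHm; rewrite -ltnS (leq_trans lt_yz).
rewrite {1}/sg (fuelE _ (tokens x).+1) //=; congr mex; apply/eq_in_map=> y.
rewrite mem_options => /(move_tokens k_gt0) lt_yx.
by apply: fuelE; rewrite // ltnW.
Qed.

Fixpoint playable (m : nat) x : bool :=
  if m is m'.+1 then has (playable m') (options x) else true.

Lemma playableP m x :
  reflect (exists2 s, path move x s & size s = m) (playable m x).
Proof.
elim: m x => [|m IHm] x /=; first by apply: (iffP idP) => // _; exists [::].
apply: (iffP hasP) => [[y] | [[|y s] //= /andP[mxy ps] [sz_s]]].
  by rewrite mem_options => mxy /IHm[s ps <-]; exists (y :: s); rewrite //= mxy.
by exists y; [rewrite mem_options | apply/IHm; exists s].
Qed.

Lemma path_size x s : 0 < k -> path move x s -> size s <= tokens x.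
Proof.
move=> k_gt0; elim: s x => //= y s IHs x /andP[/(move_tokens k_gt0) lt_yx].
by move/IHs=> le_s; apply: leq_ltn_trans lt_yx.
Qed.

(* For 0 < k no play from x is longer than (tokens x), so the bound on m does
   not restrict the maximum (see tetrisP). *)
Definition tetris x : nat := \max_(m < (tokens x).+1 | playable m x) m.

Lemma tetrisP x : 0 < k ->
  (exists2 s, path move x s & size s = tetris x) /\
  (forall s, path move x s -> size s <= tetris x).
Proof.
move=> k_gt0; split=> [|s ps].
  apply/playableP; rewrite /tetris.
  by elim/big_ind: _ => // a b Ha Hb; rewrite /maxn; case: ifP.
have lt_s : size s < (tokens x).+1 by rewrite ltnS path_size.
apply: (@leq_bigmax_cond _ (fun m : 'I__ => playable m x) val (Ordinal lt_s)).
by apply/playableP; exists s.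
Qed.

End ExactNim.

(* Main.v *)
Require Import Defs.
From mathcomp Require Import all_boot.

(** By induction on the number of tokens, Grundy and Tetris values agree on all
    options of [x]; so it suffices that the Tetris values of the options are
    exactly the numbers below [T = tetris k x] ([mex_eq]).

    No option of [x] has value [T] or more, since prefixing the move from [x]
    would give a play longer than the longest one.  Conversely, the first move
    [x -> y] of a longest play leads to value [T - 1].  Now keep the same [k]
    piles and remove further tokens from them, one at a time.  Each
    intermediate position is still an option of [x]; each single token lowers
    the Tetris value by at most one ([tetris_take1]); and once the [k] piles
    are empty only [n - k < k] piles remain, so the value is [0]
    ([move_nonempty]).  A discrete intermediate value argument
    ([options_intermediate]) then hits every value below [T].  This is the only
    place where [n < 2k] enters. *)

Section Tetris.
Set Implicit Arguments.
Unset Strict Implicit.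
Variables n k : nat.
Implicit Types x y : position n.

Lemma playableSP m x :
  reflect (exists2 y, move k x y & playable k m y) (playable k m.+1 x).
Proof.
by apply: (iffP hasP) => -[y]; rewrite ?mem_options => mxy ply;
  exists y; rewrite ?mem_options.
Qed.

(** The same amounts can be removed from the same piles of a larger position. *)
Lemma playable_mono m x y :
  (forall i, x i <= y i) -> playable k m x -> playable k m y.
Proof.
elim: m x y => // m IHm x y le_xy.
case/playableSP=> x' /andP[/forallP le_x'x card_k] play_x'.
apply/playableSP; exists [ffun i => y i - (x i - x' i)].
  apply/andP; split.
    by apply/forallP=> i; rewrite ffunE leq_subr.
  rewrite -(eqP card_k); apply/eqP/eq_card=> i; rewrite !inE ffunE.
  rewrite -[LHS]subn_gt0 subKn ?subn_gt0 //.
  by rewrite (leq_trans (leq_subr _ _)).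
apply: IHm play_x' => i; rewrite ffunE leq_subRL; last first.
  by rewrite (leq_trans (leq_subr _ _)).
by rewrite subnK.
Qed.

Definition take1 x (i : 'I_n) : position n := [ffun j => x j - (j == i)].

(** Losing one token of pile [i] costs at most one move: leave out of the play
    its first move that uses pile [i], which frees a token there, or the last
    move if pile [i] is never used. *)
Lemma playable_take1 m x i : playable k m.+1 x -> playable k m (take1 x i).
Proof.
elim: m x => // m IHm x /playableSP[y mxy play_y].
have /andP[/forallP le_yx card_k] := mxy.
have [lt_i | ge_i] := ltnP (y i) (x i).
  apply: playable_mono play_y => j; rewrite ffunE.
  have [->|_] := eqVneq j i; last by rewrite subn0.
  by rewrite subn1 -ltnS (ltn_predK lt_i).
have eq_i : y i = x i by apply/eqP; rewrite eqn_leq le_yx.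
apply/playableSP; exists (take1 y i); last exact: IHm.
apply/andP; split.
  by apply/forallP=> j; rewrite !ffunE leq_sub2r.
rewrite -(eqP card_k); apply/eqP/eq_card=> j; rewrite !inE !ffunE.
by have [->|_] := eqVneq j i; rewrite ?subn0 // eq_i !ltnn.
Qed.

Hypothesis k_gt0 : 0 < k.

Lemma playable_tetris x : playable k (tetris k x) x.
Proof. by apply/playableP; case: (tetrisP x k_gt0). Qed.

Lemma leq_tetris m x : playable k m x -> m <= tetris k x.
Proof.
by case/playableP=> s ps <-; case: (tetrisP x k_gt0) => _; apply.
Qed.

Lemma tetris_move x y : move k x y -> tetris k y < tetris k x.
Proof.
move=> mxy; apply/leq_tetris/playableSP; exists y => //.
exact: playable_tetris.
Qed.

Lemma tetris_take1 x i : (tetris k x).-1 <= tetris k (take1 x i).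
Proof.
case def_t: (tetris k x) => [//|t] /=.
by apply/leq_tetris/playable_take1; rewrite -def_t playable_tetris.
Qed.

(** The move is the first one of a longest play. *)
Lemma tetris_gt0_move x :
  0 < tetris k x -> exists2 y, move k x y & tetris k x <= (tetris k y).+1.
Proof.
case def_t: (tetris k x) (playable_tetris x) => [//|t].
by case/playableSP=> y mxy play_y _; exists y; rewrite // ltnS leq_tetris.
Qed.

Hypothesis n_lt2k : n < 2 * k.

(** The [k] piles touched by a move and the at least [k] nonempty piles of a
    position with a legal move must meet, as there are fewer than [2k] piles. *)
Lemma move_nonempty x y :
  move k x y -> 0 < tetris k y -> exists2 i, y i < x i & 0 < y i.
Proof.
move=> /andP[_ /eqP card_xy] /tetris_gt0_move[z /andP[_ /eqP card_yz] _].
set A := [set i | _] in card_xy; set B := [set i | _] in card_yz.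
have : 0 < #|A :&: B|.
  rewrite -(ltn_add2l #|A :|: B|) addn0 cardsUI card_xy card_yz addnn -mul2n.
  by rewrite (leq_ltn_trans (max_card _)) // card_ord.
case/card_gt0P=> i; rewrite !inE => /andP[lt_yx lt_zy].
by exists i; rewrite // (leq_trans _ lt_zy).
Qed.

Lemma move_take1 x y i : move k x y -> y i < x i -> move k x (take1 y i).
Proof.
move=> /andP[/forallP le_yx card_k] lt_i; apply/andP; split.
  by apply/forallP=> j; rewrite ffunE (leq_trans (leq_subr _ _)).
rewrite -(eqP card_k); apply/eqP/eq_card=> j; rewrite !inE ffunE.
have [->|_] := eqVneq j i; last by rewrite subn0.
by rewrite lt_i (leq_ltn_trans (leq_subr _ _)).
Qed.

Lemma tokens_take1 x i : 0 < x i -> tokens (take1 x i) < tokens x.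
Proof.
move=> x_gt0; rewrite /tokens (bigD1 i) //= [X in _ < X](bigD1 i) //=.
rewrite ffunE eqxx subn1 -addSn (ltn_predK x_gt0) leq_add2l leq_sum // => j _.
by rewrite ffunE leq_subr.
Qed.

(** Descend from [y] one token at a time, within the piles that the move from
    [x] has touched, until the value is [m]. *)
Lemma options_intermediate x y m :
  move k x y -> m <= tetris k y -> exists2 z, move k x z & tetris k z = m.
Proof.
have [N] := ubnP (tokens y); elim: N y => // N IHN y le_yN mxy.
rewrite leq_eqVlt => /predU1P[-> | lt_m]; first by exists y.
have [i lt_i y_gt0] := move_nonempty mxy (leq_ltn_trans (leq0n m) lt_m).
apply: (IHN (take1 y i)); last 1 first.
- by apply: leq_trans (tetris_take1 y i); rewrite -ltnS (ltn_predK lt_m).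
- exact: leq_trans (tokens_take1 y_gt0) le_yN.
- exact: move_take1.
Qed.

Lemma options_below_tetris x m :
  m < tetris k x -> exists2 y, move k x y & tetris k y = m.
Proof.
move=> lt_m; have t_gt0 := leq_ltn_trans (leq0n m) lt_m.
have [y mxy le_t] := tetris_gt0_move t_gt0.
by apply: options_intermediate mxy _; rewrite -ltnS (leq_trans lt_m).
Qed.

End Tetris.

Lemma mex_eq (s : seq nat) m :
  m \notin s -> (forall j, j < m -> j \in s) -> mex s = m.
Proof.
move=> m_s lt_s; rewrite /mex; case: ex_minnP => j j_s min_j.
apply/eqP; rewrite eqn_leq min_j //= leqNgt.
by apply: contra j_s => /lt_s.
Qed.

Theorem theorem1 (n k : nat) (hk : 1 <= k <= n) (hnk : n < 2 * k)
  (x : position n) : sg k x = tetris k x.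
Proof.
have /andP[k_gt0 _] := hk.
have [N] := ubnP (tokens x); elim: N x => // N IHN x le_xN.
have IH y : move k x y -> sg k y = tetris k y.
  by move=> /(move_tokens k_gt0) lt_yx; apply: IHN; apply: leq_trans lt_yx _.
rewrite sgE //; apply: mex_eq => [|j /options_below_tetris[]// y mxy <-].
  apply/mapP=> -[y]; rewrite mem_options => mxy def_t.
  by have := tetris_move k_gt0 mxy; rewrite def_t IH // ltnn.
by apply/mapP; exists y; rewrite ?mem_options ?IH.
Qed.
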